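(* Let $\gamma^\star$ be a minimizer over $\gamma\ge 0$ of $\mu\gamma-\lambda V(\gamma,r)$, and let $\textsc{OaRC}$ be the scheduling algorithm that in every period $t$ assigns to each waiting job $j$ the index $c(S_j(t))+V^f(\gamma^\star,S_j(t))$ and serves the $R(t)$ waiting jobs (or all of them, if fewer are waiting) with the highest indices, using a consistent tie-breaking rule. Then $\textsc{OaRC}$ is asymptotically optimal, i.e. $\mathrm{Regret}(N,\textsc{OaRC})/N\to 0$ as $N\to\infty$. More precisely, for every system size $N\ge 1$, $$\mathrm{Regret}(N,\textsc{OaRC})\le c_{\max}\,U(L,\theta,\ln N)\sqrt{N},\qquad U(L,\theta,\ln N)=1610\,\theta^{-2}L^{1.5}\ln^2(55NL).$$
   Context: Job state process: a finite state space $S$ partitioned into levels $S_0,\dots,S_{L-1}$, with $S_0=\{r\}$ (the root). Every $i\in S_\ell$ with $\ell>0$ has a unique parent $\mathrm{pa}(i)\in S_{\ell-1}$. The transition kernel $P$ on $S$ satisfies $P(\mathrm{pa}(i),i)>0$ and $P(k,i)=0$ for $k\ne \mathrm{pa}(i)$. Let $\mathrm{child}(i)=\{k:\mathrm{pa}(k)=i\}$. A state-$i$ job moves to the absorbing empty state $\perp$ (abandons) with probability $1-\sum_{k\in\mathrm{child}(i)}P(i,k)$. Let $\theta=\min_{i\in S}\bigl(1-\sum_{k\in \mathrm{child}(i)}P(i,k)\bigr)$; it is assumed that $\theta>0$. Each state has cost $c(i)>0$, and $c_{\max}=\max_i c(i)$. Queueing system of size $N\ge1$ with $\lambda\in(0,1)$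 and $\mu\in(0,1]$, in discrete periods $t=1,2,\dots$, initially empty. In period $t$: (1) $R(t)\sim\mathrm{Bin}(N,\mu)$ servers become available. (2) The algorithm selects a set of at most $R(t)$ jobs from the current queue; these leave with no further cost. (3) Every remaining waiting job $j$ incurs cost $c(S_j(t))$, where $S_j(t)$ is its state. (4) Every remaining job independently moves to a new state according to $P$; moving to $\perp$ means it leaves. (5) $A(t)\sim\mathrm{Bin}(N,\lambda)$ new jobs arrive, each with state $r$ in period $t+1$. All these random variables are independent. A feasible algorithm decides using only past and current observations (available servers, queue, current and past states, past selections and arrivals) and the model primitives ($N,\lambda,\mu,c,P$), never future information. The long-run average cost of algorithm $\mathcal A$ is $C(N,\mathcal A)=\limsup_{T\to\infty}\frac1T\mathbb E\bigl[\sum_{t=1}^T\sum_{j\text{ waiting and not served in }t}c(S_j(t))\bigr]$. Its regret is $\mathrm{Regret}(N,\mathcal A)=C(N,\mathcal A)-\inf_{\mathcal A'\text{ feasible}}C(N,\mathcal A')$. Cost-to-go: for $\gamma\ge0$, define recursively from the highest level down $$V(\gamma,i)=\min\{\gamma,\;c(i)+V^f(\gamma,i)\},\qquad V^f(\gamma,i)=\sum_{k\in\mathrm{child}(i)}P(i,k)V(\gamma,k)$$ (an empty sum is $0$). A consistent tie-breaking rule is a fixed strict total order on $S$ that ranks states by decreasing index, with jobs served according to their states' positions in this order. *)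

(* Defs.v *)
From HB Require Import structures.
From mathcomp Require Import all_boot all_order all_algebra.
From mathcomp Require Import all_classical all_reals all_analysis.
Set Implicit Arguments.
Unset Strict Implicit.
Unset Printing Implicit Defensive.
Import Order.TTheory GRing.Theory Num.Theory.
Import numFieldNormedType.Exports.
Local Open Scope classical_set_scope.
Local Open Scope ring_scope.

(* Over a finite horizon every random object below takes finitely many values,
   so its law is a finite list of weighted outcomes (outcomes may repeat; their
   weights then add up). *)
Record fdist (R : realType) (T : Type) := FDist {
  fwts : seq (R * T);
  fwts_ge0 : all (fun wx => 0 <= wx.1) fwts;
  fwts_sum1 : \sum_(wx <- fwts) wx.1 = 1 }.

Section FiniteLaws.
Variable R : realType.

Definition expect (T : Type) (d : fdist R T) (f : T -> R) : R :=
  \sum_(wx <- fwts d) wx.1 * f wx.2.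

Section Dirac.
Variables (T : Type) (x : T).
Let wts : seq (R * T) := [:: (1, x)].
Fact dirac_ge0 : all (fun wx => 0 <= wx.1) wts.
Proof. by rewrite /= ler01. Qed.
Fact dirac_sum1 : \sum_(wx <- wts) wx.1 = 1.
Proof. by rewrite big_seq1. Qed.
Definition fret : fdist R T := FDist dirac_ge0 dirac_sum1.
End Dirac.

(* Draw x from d, then an outcome from k x, using fresh randomness. *)
Section Bind.
Variables (T T' : Type) (d : fdist R T) (k : T -> fdist R T').
Let wts : seq (R * T') :=
  flatten [seq [seq (wx.1 * vy.1, vy.2) | vy <- fwts (k wx.2)] | wx <- fwts d].
Fact bind_ge0 : all (fun wx => 0 <= wx.1) wts.
Proof.
rewrite /wts; elim: (fwts d) (fwts_ge0 d) => //= wx s IH /andP[wx0 /IH s0].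
rewrite all_cat s0 andbT all_map.
by apply: sub_all (fwts_ge0 (k wx.2)) => vy /= vy0; rewrite mulr_ge0.
Qed.
Fact bind_sum1 : \sum_(wx <- wts) wx.1 = 1.
Proof.
rewrite /wts big_flatten big_map -(fwts_sum1 d); apply: eq_bigr => wx _.
by rewrite big_map /= -big_distrr /= fwts_sum1 mulr1.
Qed.
Definition fbind : fdist R T' := FDist bind_ge0 bind_sum1.
End Bind.

Lemma expect_ret (T : Type) (x : T) (f : T -> R) : expect (fret x) f = f x.
Proof. by rewrite /expect big_seq1 mul1r. Qed.

Lemma expect_bind (T T' : Type) (d : fdist R T) (k : T -> fdist R T') f :
  expect (fbind d k) f = expect d (fun x => expect (k x) f).
Proof.
rewrite /expect big_flatten big_map; apply: eq_bigr => wx _.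
rewrite big_map big_distrr /=; apply: eq_bigr => vy _.
by rewrite mulrA.
Qed.

Section Binomial.
Variables (n : nat) (p : R) (p01 : 0 <= p <= 1).
Let wts : seq (R * nat) := [seq (binomial_pmf n p k, k) | k <- iota 0 n.+1].
Fact binom_ge0 : all (fun wx => 0 <= wx.1) wts.
Proof.
by apply/allP => _ /mapP[k _ ->] /=; apply: binomial_pmf_ge0.
Qed.
Fact binom_sum1 : \sum_(wx <- wts) wx.1 = 1.
Proof.
rewrite /wts big_map -[iota 0 n.+1]/(index_iota 0 n.+1) big_mkord /=.
rewrite -[RHS](expr1n R n) -[X in X ^+ n](subrK p) exprDn.
apply: eq_bigr => k _; rewrite /binomial_pmf.
by rewrite mulrC.
Qed.
Definition fbinom : fdist R nat := FDist binom_ge0 binom_sum1.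
End Binomial.

Lemma expect_fbinom (n : nat) (p : R) (p01 : 0 <= p <= 1) (f : nat -> R) :
  expect (fbinom n p01) f = \sum_(0 <= k < n.+1) binomial_pmf n p k * f k.
Proof. by rewrite /expect /= -[RHS](big_map (fun k => (binomial_pmf n p k, k))
  xpredT (fun wx => wx.1 * f wx.2)). Qed.

End FiniteLaws.

Local Notation "'draw' x '<-' d ';' e" := (fbind d (fun x => e))
  (at level 200, x name, d at level 100, e at level 200, right associativity).

(* The level sets are S_l = {i | level i = l}, l < nlevels; the root is the only
   state without a parent. *)
Record job_process (R : realType) := JobProcess {
  state : finType;
  root : state;
  nlevels : nat;
  level : state -> nat;
  parent : state -> option state;
  trans : state -> state -> R;
  cost : state -> R;
  level_lt : forall i, (level i < nlevels)%N;
  level0 : forall i, level i = 0%N <-> i = root;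
  parent_root : parent root = None;
  parent_level : forall i, (0 < level i)%N ->
    exists2 k, parent i = Some k & (level k).+1 = level i;
  trans_parent : forall i k, parent i = Some k -> 0 < trans k i;
  trans_nparent : forall i k, parent i <> Some k -> trans k i = 0;
  cost_gt0 : forall i, 0 < cost i }.

Section JobProcess.
Variables (R : realType) (J : job_process R).

Definition child (i : state J) : {set state J} := [set k | parent k == Some i].

Definition abandon (i : state J) : R := 1 - \sum_(k in child i) trans i k.

(* The unit supplied to the iterated min (max) is itself one of its arguments,
   so these are the minimum and the maximum over all states. *)
Definition theta : R := \big[Num.min/abandon (root J)]_(i : state J) abandon i.

Definition cost_max : R := \big[Num.max/cost (root J)]_(i : state J) cost i.

(* Recursion on the number n of levels still to be explored. *)
Fixpoint cost_to_go (n : nat) (g : R) (i : state J) : R :=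
  if n is n'.+1 then
    Num.min g (cost i + \sum_(k in child i) trans i k * cost_to_go n' g k)
  else 0.

Definition V (g : R) (i : state J) : R := cost_to_go (nlevels J) g i.

Definition Vf (g : R) (i : state J) : R := \sum_(k in child i) trans i k * V g k.

Definition oarc_index (g : R) (i : state J) : R := cost i + Vf g i.

Lemma level_child (i k : state J) : k \in child i -> level k = (level i).+1.
Proof.
rewrite inE => /eqP ki; have [k0|kr] := posnP (level k).
  by move/level0: k0 ki => ->; rewrite parent_root.
by have [i' ] := parent_level kr; rewrite ki => -[<-].
Qed.

Lemma cost_to_go_fuel n m (g : R) i :
  (nlevels J <= level i + n)%N -> (nlevels J <= level i + m)%N ->
  cost_to_go n g i = cost_to_go m g i.
Proof.
have noti : ~ (nlevels J <= level i + 0)%N.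
  by rewrite addn0 leqNgt level_lt.
elim: n m i noti => [|n IH] [|m] i noti hn hm //=.
congr (Num.min _ (_ + _)); apply: eq_bigr => k ki; congr (_ * _).
have lk := level_child ki.
apply: IH; [|by rewrite lk addSnnS..].
by rewrite addn0 leqNgt level_lt.
Qed.

Lemma VE (g : R) i : V g i = Num.min g (cost i + Vf g i).
Proof.
rewrite {1}/V (@cost_to_go_fuel _ (nlevels J).+1) //= ?leq_addl //.
by rewrite addnS ltnW // ltnS leq_addl.
Qed.

End JobProcess.

Arguments oarc_index {R J} g i.

Record model (R : realType) := Model {
  process :> job_process R;
  lambda : R;
  mu : R;
  lambda01 : 0 < lambda < 1;
  mu01 : 0 < mu <= 1;
  theta_gt0 : 0 < theta process }.

Section Queue.
Variables (R : realType) (M : model R).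

Local Notation S := (state M).

(* (t, k) is the k-th arrival of the t-th period, both counted from 0. *)
Definition job : Type := (nat * nat)%type.

Definition queue : Type := seq (job * S).

(* A set of jobs of the queue q is encoded as a bit mask m along q. *)
Definition unserved (m : bitseq) (q : queue) : queue := mask (map negb m) q.

Record period := Period {
  servers : nat;
  waiting : queue;
  served : bitseq;
  arrivals : nat }.

(* Past periods, most recent first, and the current queue. *)
Definition history : Type := (seq period * queue)%type.

(* The decision may depend on everything observed so far, including the current
   number of available servers. *)
Definition algorithm : Type := history -> nat -> bitseq.

Definition feasible (alg : algorithm) : Prop :=
  forall (h : history) (n : nat),
    size (alg h n) = size h.2 /\ (count id (alg h n) <= n)%N.

Fact lambda_prob : 0 <= lambda M <= 1.
Proof. by have /andP[/ltW-> /ltW->] := lambda01 M. Qed.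

Fact mu_prob : 0 <= mu M <= 1.
Proof. by have /andP[/ltW-> ->] := mu01 M. Qed.

Section Move.
Variable i : S.
(* None is the empty state. *)
Let wts : seq (R * option S) :=
  (abandon i, None) :: [seq (trans i k, Some k) | k <- enum (child i)].
Fact move_ge0 : all (fun wx => 0 <= wx.1) wts.
Proof.
apply/allP => wx; rewrite inE => /orP[/eqP-> /=|/mapP[k]].
  apply/ltW; apply: lt_le_trans (theta_gt0 M) _.
  exact: bigmin_le_cond.
rewrite mem_enum inE => /eqP ki -> /=.
exact/ltW/trans_parent.
Qed.
Fact move_sum1 : \sum_(wx <- wts) wx.1 = 1.
Proof. by rewrite /wts big_cons big_map big_enum /= /abandon subrK. Qed.
Definition move : fdist R (option S) := FDist move_ge0 move_sum1.
End Move.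

Lemma expect_move (i : S) (f : option S -> R) :
  expect (move i) f =
  abandon i * f None + \sum_(k in child i) trans i k * f (Some k).
Proof. by rewrite /expect /= big_cons big_map big_enum. Qed.

Fixpoint move_all (q : queue) : fdist R queue :=
  if q is x :: q' then
    draw o <- move x.2;
    draw q'' <- move_all q';
    fret R (if o is Some k then (x.1, k) :: q'' else q'')
  else fret R [::].

Definition new_jobs (t a : nat) : queue := [seq ((t, k), root M) | k <- iota 0 a].

Definition one_period (N : nat) (alg : algorithm) (h : history) :
    fdist R history :=
  draw n <- fbinom N mu_prob;
  draw q <- move_all (unserved (alg h n) h.2);
  draw a <- fbinom N lambda_prob;
  fret R (Period n h.2 (alg h n) a :: h.1, q ++ new_jobs (size h.1) a).

Fixpoint law (N : nat) (alg : algorithm) (T : nat) : fdist R history :=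
  if T is T'.+1 then draw h <- law N alg T'; one_period N alg h
  else fret R ([::], [::]).

Definition period_cost (p : period) : R :=
  \sum_(x <- unserved (served p) (waiting p)) cost x.2.

Definition total_cost (h : history) : R := \sum_(p <- h.1) period_cost p.

Definition average_cost (N : nat) (alg : algorithm) : \bar R :=
  limn_esup (fun T => (T%:R^-1 * expect (law N alg T) total_cost)%:E).

Definition optimal_cost (N : nat) : \bar R :=
  ereal_inf [set average_cost N alg | alg in feasible].

Definition regret (N : nat) (alg : algorithm) : \bar R :=
  (average_cost N alg - optimal_cost N)%E.

Definition dual_minimizer (g : R) : Prop :=
  0 <= g /\ forall g', 0 <= g' ->
    mu M * g - lambda M * V g (root M) <= mu M * g' - lambda M * V g' (root M).

(* before i k: state i precedes state k in the service order. *)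
Definition tie_breaking (g : R) (before : rel S) : Prop :=
  [/\ irreflexive before, transitive before,
      (forall i k, i != k -> before i k || before k i)
    & (forall i k, oarc_index g k < oarc_index g i -> before i k)].

(* Among jobs in the same state the choice is left open. *)
Definition is_OaRC (before : rel S) (alg : algorithm) : Prop :=
  forall (h : history) (n : nat),
    [/\ size (alg h n) = size h.2,
        count id (alg h n) = minn n (size h.2)
      & forall x y, x \in mask (alg h n) h.2 -> y \in unserved (alg h n) h.2 ->
          ~~ before y.2 x.2].

Lemma OaRC_feasible before alg : is_OaRC before alg -> feasible alg.
Proof. by move=> O h n; have [-> -> _] := O h n; rewrite geq_minl. Qed.

End Queue.

Arguments feasible {R M} alg.

Definition U (R : realType) (L : nat) (th : R) (N : nat) : R :=
  1610 * th ^- 2 * L%:R `^ (3 / 2) * ln (55 * N * L)%:R ^+ 2.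

(* Main.v *)
(* Price a service at the dual minimiser g. The potential (sum of V(g, state) over
   the queue) gives weak duality: no feasible algorithm costs less per period than
   N (lambda V(g, r) - mu g). Applied to OaRC, the same potential bounds the regret
   by the mean number of jobs of index > g left unserved (excess), plus the mean
   number of servers not used on jobs of index >= g (shortage), both weighted by at
   most c_max / theta.

   Let A be {index > g} or {index >= g}. The first-order conditions at g say that,
   if no job were served outside A, first visits to A would occur at mean rate at
   most mu N, respectively at least mu N. The expected number of first visits to A in
   a given period, with served jobs counted as if they had stayed, is a martingale;
   its variance is at most L N, since a job lives for at most L periods. So it is
   off its mean by O(sqrt (L N)) only.

   The real number of A-jobs differs from this in two ways: an unserved A-job may
   visit A again, and a job served outside A (which takes a shortage) is missed in A
   later. Either event has probability at most 1 - theta, so summing over time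
   yields total <= noise + (1 - theta) total, i.e. total <= noise / theta. *)
Require Import Defs.
From HB Require Import structures.
From mathcomp Require Import all_boot all_order all_algebra.
From mathcomp Require Import ring lra.
From mathcomp Require Import all_classical all_reals all_analysis.
Set Implicit Arguments.
Unset Strict Implicit.
Unset Printing Implicit Defensive.
Import Order.TTheory GRing.Theory Num.Theory.
Import numFieldNormedType.Exports.
Local Open Scope classical_set_scope.
Local Open Scope ring_scope.

(* The root of a job tree, not the roots of a polynomial. *)
Local Notation root := Defs.root.

(** * Expectations over finite laws and binomial moments *)

Section Expectation.
Variable R : realType.

Section OneLaw.
Variables (T : Type) (d : fdist R T).
Implicit Types f g : T -> R.

Lemma expect_cst (c : R) : expect d (fun=> c) = c.
Proof. by rewrite /expect -big_distrl /= fwts_sum1 mul1r. Qed.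

Lemma expectD f g : expect d (fun x => f x + g x) = expect d f + expect d g.
Proof.
by rewrite /expect -big_split; apply: eq_bigr => wx _; rewrite mulrDr.
Qed.

Lemma expectZ (c : R) f : expect d (fun x => c * f x) = c * expect d f.
Proof.
by rewrite /expect big_distrr; apply: eq_bigr => wx _; rewrite /= mulrCA.
Qed.

Lemma eq_expect f g : (forall x, f x = g x) -> expect d f = expect d g.
Proof. by move=> fg; apply: eq_bigr => wx _; rewrite fg. Qed.

Lemma expectDr (c : R) f : expect d (fun x => f x + c) = expect d f + c.
Proof. by rewrite expectD expect_cst. Qed.

Lemma expectN f : expect d (fun x => - f x) = - expect d f.
Proof.
rewrite -mulN1r -expectZ; apply: eq_expect => x.
by rewrite mulN1r.
Qed.

Lemma expectB f g : expect d (fun x => f x - g x) = expect d f - expect d g.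
Proof. by rewrite expectD expectN. Qed.

Lemma le_expect f g : (forall x, f x <= g x) -> expect d f <= expect d g.
Proof.
move=> fg; rewrite /expect; elim: (fwts d) (fwts_ge0 d) => [|wx s IH] /=.
  by rewrite !big_nil.
by case/andP=> w0 s0; rewrite !big_cons lerD ?IH// ler_wpM2l.
Qed.

Lemma expect_ge0 f : (forall x, 0 <= f x) -> 0 <= expect d f.
Proof. by move=> f0; rewrite -[X in X <= _](expect_cst 0); apply: le_expect. Qed.

(* Optimises [|y| <= y^2 / (2 b) + b / 2]. *)
Lemma expect_norm_le f (b : R) : 0 < b ->
  expect d (fun x => f x ^+ 2) <= b ^+ 2 -> expect d (fun x => `|f x|) <= b.
Proof.
move=> b0 fb.
have -> : b = (2 * b)^-1 * b ^+ 2 + b / 2 by field; rewrite gt_eqF.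
apply: (@le_trans _ _ (expect d (fun x => (2 * b)^-1 * f x ^+ 2 + b / 2))).
  apply: le_expect => x; rewrite -subr_ge0.
  have -> : (2 * b)^-1 * f x ^+ 2 + b / 2 - `|f x| =
            (2 * b)^-1 * (`|f x| - b) ^+ 2.
    by rewrite -(real_normK (num_real (f x))); field; rewrite gt_eqF.
  by rewrite mulr_ge0 ?sqr_ge0// invr_ge0 mulr_ge0// ltW.
rewrite expectDr expectZ lerD2r ler_wpM2l//.
by rewrite invr_ge0 mulr_ge0// ltW.
Qed.

End OneLaw.

Section BinomialMoments.
Variables (p : R) (p01 : 0 <= p <= 1).

Lemma expect_fbinom0 (f : nat -> R) : expect (fbinom 0 p01) f = f 0%N.
Proof.
rewrite expect_fbinom big_nat1 /binomial_pmf !expr0 mulr1 bin0 mulr1n.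
by rewrite mul1r.
Qed.

(** Conditioning on one trial, by Pascal's rule; the moments below follow by induction on [n]. *)
Lemma expect_fbinomS (n : nat) (f : nat -> R) :
  expect (fbinom n.+1 p01) f =
  (1 - p) * expect (fbinom n p01) f + p * expect (fbinom n p01) (f \o succn).
Proof.
rewrite !expect_fbinom !big_mkord !big_distrr /=.
rewrite big_ord_recl [X in _ = X + _]big_ord_recl [X in _ + X = _]big_ord_recr.
rewrite [X in _ = _ + X]big_ord_recr /= -!addrA; congr (_ + _).
  by rewrite /binomial_pmf !bin0 !expr0 !subn0 exprS /unstable.onem; ring.
rewrite addrA -big_split /=; congr (_ + _); last first.
  by rewrite /binomial_pmf !binn !subnn exprS; ring.
apply: eq_bigr => k _; rewrite /binomial_pmf /bump /= !add1n.
rewrite subSS binS mulrnDr exprS /unstable.onem.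
have [kn] : exists m, (n - k = m.+1)%N.
  by exists (n - k.+1)%N; rewrite subnSK.
move=> e; have -> : (n - k.+1 = kn)%N by rewrite subnS e.
by rewrite e exprS; ring.
Qed.

Lemma expect_fbinom_affine (n : nat) (y : R) :
  expect (fbinom n p01) (fun k => k%:R + y) = p * n%:R + y.
Proof.
elim: n y => [|n IH] y; first by rewrite expect_fbinom0 mulr0.
rewrite expect_fbinomS IH.
rewrite (eq_expect _ (g := fun k => k%:R + (1 + y))); last first.
  by move=> k /=; rewrite -natr1 addrA.
by rewrite IH -natr1; ring.
Qed.

Lemma expect_fbinom_mean (n : nat) :
  expect (fbinom n p01) (fun k => k%:R) = p * n%:R.
Proof.
by rewrite -[RHS]addr0 -expect_fbinom_affine; apply: eq_expect => k; rewrite addr0.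
Qed.

(** Variance at most mean. The shift [y] is left free so that the induction can absorb one trial
    into it, and so that independent sources of noise can later be peeled off one at a time. *)
Lemma expect_fbinom_sqr (n : nat) (c y : R) :
  expect (fbinom n p01) (fun k => (c * k%:R + y) ^+ 2) <=
  (c * (p * n%:R) + y) ^+ 2 + p * n%:R * c ^+ 2.
Proof.
have /andP[p0 p1] := p01.
elim: n y => [|n IH] y; first by rewrite expect_fbinom0 !mulr0 mul0r addr0.
rewrite expect_fbinomS.
rewrite (@eq_expect _ _ (_ \o _) (fun k => (c * k%:R + (c + y)) ^+ 2));
  last first.
  by move=> k /=; rewrite -natr1; ring.
apply: le_trans (lerD (ler_wpM2l _ (IH _)) (ler_wpM2l p0 (IH _))) _.
  by rewrite subr_ge0.
rewrite -subr_ge0 -natr1.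
(* The slack comes from bounding the variance [p - p ^+ 2] of one trial by [p]. *)
rewrite [X in 0 <= X](_ : _ = (p * c) ^+ 2); first exact: sqr_ge0.
ring.
Qed.

End BinomialMoments.
End Expectation.

(** * Visits to a set [A] of states along the job tree *)

Section Hitting.
Variables (R : realType) (J : job_process R).
Implicit Types (i k : state J) (f : state J -> R).

Definition next f i : R := \sum_(k in child i) trans i k * f k.

Lemma trans_ge0 i k : k \in child i -> 0 <= trans i k.
Proof. by rewrite inE => /eqP ki; exact/ltW/trans_parent. Qed.

Lemma eq_next f f' i :
  {in child i, forall k, f k = f' k} -> next f i = next f' i.
Proof. by move=> ff'; apply: eq_bigr => k ki; rewrite ff'. Qed.

Lemma le_next f f' i :
  {in child i, forall k, f k <= f' k} -> next f i <= next f' i.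
Proof. by move=> ff'; apply: ler_sum => k ki; rewrite ler_wpM2l ?trans_ge0 ?ff'. Qed.

Lemma next0 f i : {in child i, forall k, f k = 0} -> next f i = 0.
Proof. by move=> f0; apply: big1 => k ki; rewrite f0 ?mulr0. Qed.

Lemma nextD f f' i : next (fun k => f k + f' k) i = next f i + next f' i.
Proof. by rewrite /next -big_split; apply: eq_bigr => k _; rewrite mulrDr. Qed.

Lemma nextZ (c : R) f i : next (fun k => c * f k) i = c * next f i.
Proof. by rewrite /next big_distrr; apply: eq_bigr => k _; rewrite /= mulrCA. Qed.

Lemma next_sum n (h : nat -> state J -> R) i :
  next (fun k => \sum_(m < n) h m k) i = \sum_(m < n) next (h m) i.
Proof. by rewrite exchange_big; apply: eq_bigr => k _; rewrite big_distrr. Qed.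

Lemma next_ge0 f i : (forall k, 0 <= f k) -> 0 <= next f i.
Proof. by move=> f0; apply: sumr_ge0 => k ki; rewrite mulr_ge0 ?trans_ge0. Qed.

Lemma next_cst (c : R) i : next (fun=> c) i = (1 - abandon i) * c.
Proof. by rewrite /next -big_distrl /= /abandon opprB addrC subrK. Qed.

Lemma theta_le i : theta J <= abandon i.
Proof. exact: bigmin_le_cond. Qed.

Lemma next_le (c : R) f i : 0 <= c -> (forall k, f k <= c) ->
  next f i <= (1 - theta J) * c.
Proof.
move=> c0 fc; apply: (@le_trans _ _ (next (fun=> c) i)); first exact: le_next.
by rewrite next_cst ler_wpM2r// lerD2l lerN2 theta_le.
Qed.

Lemma theta_le1 : theta J <= 1.
Proof.
rewrite (le_trans (theta_le (root J)))// /abandon gerBl.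
by apply: sumr_ge0 => k; exact: trans_ge0.
Qed.

Lemma level_root : level (root J) = 0%N.
Proof. exact/level0. Qed.

Lemma nlevels_gt0 : (0 < nlevels J)%N.
Proof. by apply: leq_trans (level_lt (root J)); rewrite ltnS. Qed.

Variable A : pred (state J).

Fixpoint hit_within (n : nat) i : R :=
  if n is n'.+1 then if A i then 1 else next (hit_within n') i else 0.

(** Probability that a job in state [i], if never served, is in [A] now or later; a path in the tree
    has at most [nlevels J] states. *)
Definition hit i : R := hit_within (nlevels J) i.

Lemma hit_within_fuel n m i :
  (nlevels J <= level i + n)%N -> (nlevels J <= level i + m)%N ->
  hit_within n i = hit_within m i.
Proof.
have no i' : ~ (nlevels J <= level i' + 0)%N by rewrite addn0 leqNgt level_lt.
elim: n m i => [|n IH] [|m] i //.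
- by move=> /no.
- by move=> _ /no.
move=> hn hm /=; case: ifP => // _; apply: eq_next => k /level_child lk.
by apply: IH; rewrite lk addSnnS.
Qed.

Lemma hitE i : hit i = if A i then 1 else next hit i.
Proof.
rewrite {1}/hit (@hit_within_fuel _ (nlevels J).+1) //= ?leq_addl //.
by rewrite addnS ltnW // ltnS leq_addl.
Qed.

Lemma hit_within_ge0 n i : 0 <= hit_within n i.
Proof.
by elim: n i => //= n IH i; case: ifP => // _; exact: next_ge0.
Qed.

Lemma hit_ge0 i : 0 <= hit i.
Proof. exact: hit_within_ge0. Qed.

Lemma hit_within_le1 n i : 0 <= theta J -> hit_within n i <= 1.
Proof.
move=> th0; elim: n i => //= n IH i; case: ifP => // _.
by apply: le_trans (next_le i ler01 IH) _; rewrite mulr1 gerBl.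
Qed.

Lemma hit_le1 i : 0 <= theta J -> hit i <= 1.
Proof. exact: hit_within_le1. Qed.

Lemma next_hit_le i : 0 <= theta J -> next hit i <= 1 - theta J.
Proof.
by move=> th0; apply: le_trans (next_le i ler01 (fun k => hit_le1 k th0)) _;
  rewrite mulr1.
Qed.

Fixpoint fresh_within (n : nat) i : bool :=
  if n is n'.+1 then
    if parent i is Some k then ~~ A k && fresh_within n' k else true
  else true.

(* No strict ancestor of [i] lies in [A]: since the states form a tree, a job in
   state [i] then visits [A] now for the first time, or has not visited it yet. *)
Definition fresh i : bool := fresh_within (level i) i.

Lemma fresh_root : fresh (root J).
Proof. by rewrite /fresh level_root. Qed.

Lemma fresh_child i k : k \in child i -> fresh k = ~~ A i && fresh i.
Proof.
move=> ki; rewrite /fresh (level_child ki) /=.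
by move: ki; rewrite inE => /eqP ->.
Qed.

(* Probability that a job in state [i], if never served, is in [A] for the first
   time exactly [n] periods later. *)
Fixpoint first_hit (n : nat) i : R :=
  if n is n'.+1 then next (first_hit n') i else (A i && fresh i)%:R.

Lemma first_hit_ge0 n i : 0 <= first_hit n i.
Proof. by elim: n i => //= n IH i; exact: next_ge0. Qed.

Lemma first_hit_le1 n i : 0 <= theta J -> first_hit n i <= 1.
Proof.
move=> th0; elim: n i => /= [|n IH] i; first by case: (A i && _).
by apply: le_trans (next_le i ler01 IH) _; rewrite mulr1 gerBl.
Qed.

Lemma first_hit_nfresh n i : ~~ fresh i -> first_hit n i = 0.
Proof.
elim: n i => /= [|n IH] i ni; first by rewrite (negbTE ni) andbF.
by apply: next0 => k /fresh_child ki; rewrite IH// ki (negbTE ni) andbF.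
Qed.

Lemma first_hitS_in n i : A i -> first_hit n.+1 i = 0.
Proof.
by move=> Ai /=; apply: next0 => k /fresh_child ki; rewrite first_hit_nfresh// ki Ai.
Qed.

Lemma first_hit_late n i : (nlevels J <= level i + n)%N -> first_hit n i = 0.
Proof.
elim: n i => /= [|n IH] i; first by rewrite addn0 leqNgt level_lt.
by move=> h; apply: next0 => k /level_child lk; rewrite IH// lk addSnnS.
Qed.

(** First visits at different times are disjoint events. Freshness excludes a visit before [i], so
    the first visit from [i] on is the first of all. *)
Lemma sum_first_hit n i : fresh i -> \sum_(m < n) first_hit m i = hit_within n i.
Proof.
elim: n i => [|n IH] i fi; first by rewrite big_ord0.
rewrite big_ord_recl /= fi andbT; case: ifPn => Ai.
  by rewrite big1 ?addr0// => m _; exact: first_hitS_in.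
rewrite add0r -next_sum; apply: eq_next => k /fresh_child ki.
by rewrite IH// ki fi Ai.
Qed.

Lemma sum_first_hit_root n : (nlevels J <= n)%N ->
  \sum_(m < n) first_hit m (root J) = hit (root J).
Proof.
move=> Ln; rewrite sum_first_hit ?fresh_root//.
by apply: hit_within_fuel; rewrite level_root.
Qed.

Lemma sum_first_hit_root_le n : 0 <= theta J ->
  \sum_(m < n) first_hit m (root J) <= hit (root J).
Proof.
move=> th0; rewrite -(sum_first_hit_root (leq_addr n (nlevels J))).
rewrite addnC big_split_ord /= lerDl; apply: sumr_ge0 => m _.
exact: first_hit_ge0.
Qed.

End Hitting.

(** * Sums over the queue and their moments under one round of moves *)

Section QueueSums.
Variables (R : realType) (M : model R).
Implicit Types (q : queue M) (f : state M -> R) (m : bitseq).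

Definition qsum f q : R := \sum_(x <- q) f x.2.

Lemma qsum_cat f q q' : qsum f (q ++ q') = qsum f q + qsum f q'.
Proof. by rewrite /qsum big_cat. Qed.

Lemma eq_qsum f f' q : f =1 f' -> qsum f q = qsum f' q.
Proof. by move=> ff'; apply: eq_bigr => x _; rewrite ff'. Qed.

Lemma le_qsum f f' q : (forall i, f i <= f' i) -> qsum f q <= qsum f' q.
Proof. by move=> ff'; apply: ler_sum. Qed.

Lemma qsum_ge0 f q : (forall i, 0 <= f i) -> 0 <= qsum f q.
Proof. by move=> f0; apply: sumr_ge0. Qed.

Lemma qsum0 f q : (forall i, f i = 0) -> qsum f q = 0.
Proof. by move=> f0; apply: big1. Qed.

Lemma qsumD f f' q : qsum (fun i => f i + f' i) q = qsum f q + qsum f' q.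
Proof. exact: big_split. Qed.

Lemma qsumZ (c : R) f q : qsum (fun i => c * f i) q = c * qsum f q.
Proof. by rewrite /qsum big_distrr. Qed.

Lemma qsumB f f' q : qsum (fun i => f i - f' i) q = qsum f q - qsum f' q.
Proof. by rewrite /qsum sumrB. Qed.

Lemma qsum1 q : qsum (fun=> 1) q = (size q)%:R.
Proof. by rewrite /qsum big_const_seq count_predT iter_addr_0. Qed.

Lemma qsum_split f m q : size m = size q ->
  qsum f q = qsum f (mask m q) + qsum f (unserved m q).
Proof.
rewrite /qsum /unserved; elim: q m => [|x q IH] [|b m] //=.
  by rewrite !big_nil addr0.
by case=> /IH e; case: b; rewrite /= !big_cons e; ring.
Qed.

Lemma qsum_new f q t a :
  qsum f (q ++ new_jobs M t a) = f (root M) * a%:R + qsum f q.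
Proof.
rewrite qsum_cat addrC; congr (_ + _); rewrite /qsum big_map /=.
by rewrite big_const_seq count_predT size_iota iter_addr_0 mulr_natr.
Qed.

Lemma expect_move_all f q :
  expect (move_all q) (qsum f) = qsum (next f) q.
Proof.
elim: q => [|x q IH] /=; first by rewrite expect_ret /qsum !big_nil.
rewrite expect_bind expect_move /qsum big_cons -/(qsum _ q) -IH.
have step (o : option (state M)) (b : R) :
    (forall q', qsum f (if o is Some k then (x.1, k) :: q' else q') =
       b + qsum f q') ->
    expect (fbind (move_all q) (fun q' =>
      fret R (if o is Some k then (x.1, k) :: q' else q'))) (qsum f) =
    b + expect (move_all q) (qsum f).
  move=> ob; rewrite expect_bind addrC -expectDr; apply: eq_expect => q'.
  by rewrite expect_ret ob addrC.
rewrite (step None 0) => [|q']; last by rewrite add0r.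
under eq_bigr => k _.
  rewrite (step (Some k) (f k)) => [|q']; last by rewrite /qsum big_cons.
  rewrite mulrDr; over.
rewrite big_split /= -/(next f x.2) -big_distrl /= add0r /abandon.
ring.
Qed.

(** Values in [0, 1] dominate their squares, so the variance is at most the mean. *)
Lemma expect_move_sqr (i : state M) f (y : R) : (forall k, 0 <= f k <= 1) ->
  expect (move i) (fun o => (oapp f 0 o + y) ^+ 2) <=
  (next f i + y) ^+ 2 + next f i.
Proof.
move=> f01.
have en : next f i = expect (move i) (fun o => oapp f 0 o).
  by rewrite expect_move /= mulr0 add0r.
apply: (@le_trans _ _ (expect (move i)
    (fun o => (1 + 2 * y) * oapp f 0 o + y ^+ 2))).
  apply: le_expect => -[k|] /=; last by rewrite mulr0 !add0r.
  by have /andP[f0 f1] := f01 k; nra.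
rewrite expectDr expectZ -en.
by have := sqr_ge0 (next f i); nra.
Qed.

(** Jobs move independently, so variances add: the first job is treated with the mean of the others
    in the shift [y]. *)
Lemma expect_move_all_sqr f q (y : R) : (forall k, 0 <= f k <= 1) ->
  expect (move_all q) (fun q' => (qsum f q' + y) ^+ 2) <=
  (qsum (next f) q + y) ^+ 2 + qsum (next f) q.
Proof.
move=> f01; elim: q y => [|x q IH] y /=.
  by rewrite expect_ret /qsum !big_nil addr0.
rewrite expect_bind.
apply: (@le_trans _ _ (expect (move x.2) (fun o =>
    (oapp f 0 o + (qsum (next f) q + y)) ^+ 2 + qsum (next f) q))).
  apply: le_expect => o; rewrite expect_bind.
  apply: le_trans (_ : expect (move_all q)
    (fun q' => (qsum f q' + (oapp f 0 o + y)) ^+ 2) <= _).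
    rewrite le_eqVlt; apply/orP; left; apply/eqP; apply: eq_expect => q'.
    rewrite expect_ret; congr (_ ^+ 2).
    by case: o => [k|] /=; rewrite /qsum ?big_cons; ring.
  apply: le_trans (IH _) _.
  by rewrite lerD2r le_eqVlt; apply/orP; left; apply/eqP; congr (_ ^+ 2); ring.
rewrite expectDr.
apply: le_trans (lerD (expect_move_sqr _ _ f01) (lexx _)) _.
rewrite /qsum big_cons -/(qsum _ q) -!addrA lerD2r.
by rewrite le_eqVlt; apply/orP; left; apply/eqP; congr (_ ^+ 2); ring.
Qed.

End QueueSums.

(** * Drift over one period, mean queue length and weak duality *)

Section Dynamics.
Variables (R : realType) (M : model R) (N : nat) (alg : algorithm M).
Implicit Types (h : history M) (f : state M -> R).

Local Notation E t := (expect (law N alg t)).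
Local Notation Es := (expect (fbinom N (mu_prob M))).
Local Notation step h := (expect (one_period N alg h)).
Local Notation lamN := (lambda M * N%:R).

Let theta0 : 0 <= theta M := ltW (theta_gt0 M).

Lemma expect_one_period h (F : history M -> R) :
  step h F = Es (fun n =>
    expect (move_all (unserved (alg h n) h.2)) (fun q =>
      expect (fbinom N (lambda_prob M)) (fun a =>
        F (Period n h.2 (alg h n) a :: h.1, q ++ new_jobs M (size h.1) a)))).
Proof.
rewrite /one_period expect_bind; apply: eq_expect => n.
rewrite expect_bind; apply: eq_expect => q.
by rewrite expect_bind; apply: eq_expect => a; rewrite expect_ret.
Qed.

Lemma step_qsum h f :
  step h (fun h' => qsum f h'.2) =
  Es (fun n => qsum (next f) (unserved (alg h n) h.2)) + lamN * f (root M).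
Proof.
rewrite expect_one_period -expectDr; apply: eq_expect => n.
rewrite -expect_move_all -expectDr; apply: eq_expect => q /=.
under eq_expect => a do rewrite qsum_new.
by rewrite expectDr expectZ expect_fbinom_mean; ring.
Qed.

(** Telescoping: [F] is a potential and [G] bounds its drift. The bounds on sums over time rest on
    suitable choices of [F]. *)
Lemma amortized_le (F G : history M -> R) T :
  (forall h, step h F <= F h + G h) ->
  E T F <= F ([::], [::]) + \sum_(t < T) E t G.
Proof.
move=> FG; elim: T => [|T IH]; first by rewrite expect_ret big_ord0 addr0.
rewrite big_ord_recr /= expect_bind addrA.
apply: le_trans (le_expect _ FG) _.
by rewrite expectD lerD2r.
Qed.

Lemma amortized_eq (F G : history M -> R) T :
  (forall h, step h F = F h + G h) ->
  E T F = F ([::], [::]) + \sum_(t < T) E t G.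
Proof.
move=> FG; elim: T => [|T IH]; first by rewrite expect_ret big_ord0 addr0.
rewrite big_ord_recr /= expect_bind addrA -IH -expectD.
exact: eq_expect.
Qed.

Definition unserved_cost h : R :=
  Es (fun n => qsum (@cost _ M) (unserved (alg h n) h.2)).

Lemma expect_total_cost T :
  E T (@total_cost _ M) = \sum_(t < T) E t unserved_cost.
Proof.
rewrite (@amortized_eq _ unserved_cost) => [|h].
  by rewrite /total_cost big_nil add0r.
rewrite expect_one_period [RHS]addrC -expectDr; apply: eq_expect => n.
rewrite -[RHS](expect_cst (move_all (unserved (alg h n) h.2))).
apply: eq_expect => q /=.
rewrite -[RHS](expect_cst (fbinom N (lambda_prob M))).
by apply: eq_expect => a; rewrite /total_cost /= big_cons.
Qed.

Section MeanQueueLength.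
Hypothesis feas : feasible alg.

Let split_queue h n f :
  qsum f h.2 = qsum f (mask (alg h n) h.2) + qsum f (unserved (alg h n) h.2).
Proof. by apply: qsum_split; have [] := feas h n. Qed.

Lemma qsum_unserved_le h n f : (forall i, 0 <= f i) ->
  qsum f (unserved (alg h n) h.2) <= qsum f h.2.
Proof. by move=> f0; rewrite (split_queue h n) lerDr qsum_ge0. Qed.

Lemma size_served h n : size (mask (alg h n) h.2) = count id (alg h n).
Proof. by have [sz _] := feas h n; rewrite size_mask. Qed.

(** The mean length contracts by [1 - theta M] and grows by at most [N] per period; the bound is the
    fixed point. Being uniform in [T], it makes the potential left at the horizon negligible on
    average. *)
Lemma expect_queue_size_le T :
  E T (fun h => (size h.2)%:R) <= N%:R / theta M.
Proof.
have th := theta_gt0 M; have th1 := theta_le1 M.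
have lam1 : lambda M <= 1 by case/andP: (lambda_prob M).
rewrite (@eq_expect _ _ _ _ (fun h => qsum (fun=> 1) h.2)) => [|h];
  last by rewrite qsum1.
elim: T => [|T IH].
  by rewrite expect_ret /qsum big_nil divr_ge0 ?theta0.
rewrite /= expect_bind.
apply: (@le_trans _ _ (E T (fun h => (1 - theta M) * qsum (fun=> 1) h.2 + N%:R))).
  apply: le_expect => h; rewrite step_qsum mulr1 lerD//; last first.
    by rewrite ler_piMl.
  rewrite -[X in _ <= X](expect_cst (fbinom N (mu_prob M))).
  apply: le_expect => n.
  apply: (@le_trans _ _ (qsum (fun=> 1 - theta M) (unserved (alg h n) h.2))).
    apply: le_qsum => i; apply: le_trans (next_le i ler01 (fun=> lexx _)) _.
    by rewrite mulr1.
  rewrite -qsumZ; under [X in _ <= X]eq_qsum do rewrite mulr1.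
  by apply: qsum_unserved_le => i; rewrite subr_ge0.
rewrite expectDr expectZ.
have -> : N%:R / theta M = (1 - theta M) * (N%:R / theta M) + N%:R.
  by field; rewrite gt_eqF.
by rewrite lerD2r ler_wpM2l// subr_ge0.
Qed.

(* Weak duality: [V g i] is at most the price [g] of serving a job in state [i],
   and at most the cost of letting it wait one more period. *)
Lemma expect_total_cost_ge (g : R) T : 0 <= g ->
  T%:R * (N%:R * (lambda M * V g (root M) - mu M * g)) - g * (N%:R / theta M)
  <= E T (@total_cost _ M).
Proof.
move=> g0; rewrite expect_total_cost.
have stepV h : step h (fun h' => - qsum (V g) h'.2) <=
    - qsum (V g) h.2 +
    (unserved_cost h - N%:R * (lambda M * V g (root M) - mu M * g)).
  rewrite expectN step_qsum.
  suff : qsum (V g) h.2 <= Es (fun n => g * n%:R +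
      (qsum (@cost _ M) (unserved (alg h n) h.2) +
       qsum (next (V g)) (unserved (alg h n) h.2))).
    by rewrite !expectD expectZ expect_fbinom_mean -/(unserved_cost h); lra.
  rewrite -[X in X <= _](expect_cst (fbinom N (mu_prob M))).
  apply: le_expect => n; rewrite (split_queue h n) lerD//.
    apply: (@le_trans _ _ (qsum (fun=> g * 1) (mask (alg h n) h.2))).
      by apply: le_qsum => i; rewrite VE mulr1 ge_min lexx.
    rewrite qsumZ qsum1 ler_wpM2l// size_served ler_nat.
    by have [] := feas h n.
  by rewrite -qsumD; apply: le_qsum => i; rewrite VE ge_min lexx orbT.
have := amortized_le T stepV.
rewrite /qsum big_nil -/(qsum _ _) oppr0 add0r.
under [X in _ <= X]eq_bigr => t _ do rewrite expectDr.
rewrite big_split /= sumr_const card_ord -[_ *+ T]mulr_natl expectN.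
have sizeV : E T (fun h => qsum (V g) h.2) <= g * (N%:R / theta M).
  apply: le_trans (ler_wpM2l g0 (expect_queue_size_le T)).
  rewrite -expectZ; apply: le_expect => h.
  rewrite -qsum1 -qsumZ; apply: le_qsum => i.
  by rewrite mulr1 VE ge_min lexx.
rewrite /qsum in sizeV *; lra.
Qed.

End MeanQueueLength.
End Dynamics.

(** * The martingale of foreseen first visits and its variance *)

Section FirstHitMartingale.
Variables (R : realType) (M : model R) (N : nat) (alg : algorithm M).
Hypothesis feas : feasible alg.
Variable A : pred (state M).
Implicit Types (h : history M) (f : state M -> R).

Local Notation E t := (expect (law N alg t)).
Local Notation Es := (expect (fbinom N (mu_prob M))).
Local Notation step h := (expect (one_period N alg h)).
Local Notation lamN := (lambda M * N%:R).
Local Notation fh := (first_hit A).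

Let theta0 : 0 <= theta M := ltW (theta_gt0 M).

Let lamN_ge0 : 0 <= lamN.
Proof. by rewrite mulr_ge0//; case/andP: (lambda_prob M). Qed.

Let lamN_le : lamN <= N%:R.
Proof. by rewrite ler_piMl//; case/andP: (lambda_prob M). Qed.

Let split_queue h n f :
  qsum f h.2 = qsum f (mask (alg h n) h.2) + qsum f (unserved (alg h n) h.2).
Proof. by apply: qsum_split; have [] := feas h n. Qed.

(* A job served [j] periods before the most recent one counts with weight
   [w (k + j)]. *)
Fixpoint past_served (w : nat -> state M -> R) (k : nat) (l : seq (period M)) : R :=
  if l is p :: l' then
    qsum (w k) (mask (served p) (waiting p)) + past_served w k.+1 l'
  else 0.

Lemma past_served_ge0 w k l : (forall n i, 0 <= w n i) -> 0 <= past_served w k l.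
Proof.
by move=> w0; elim: l k => //= p l IH k; rewrite addr_ge0 ?qsum_ge0.
Qed.

Lemma step_past_served w k h :
  step h (fun h' => past_served w k h'.1) =
  Es (fun n => qsum (w k) (mask (alg h n) h.2)) + past_served w k.+1 h.1.
Proof.
rewrite expect_one_period -expectDr; apply: eq_expect => n.
rewrite -[RHS](expect_cst (move_all (unserved (alg h n) h.2))).
by apply: eq_expect => q; rewrite /= expect_cst.
Qed.

(** Share of the jobs that are still to arrive in the next [n] periods: at the end of these, they
    have made between 0 and [n - 1] moves. *)
Definition arrived_hits (n : nat) : R := lamN * \sum_(m < n) fh m (root M).

(* Expected number of first visits to [A] in [n] periods from now if no job is
   served from now on, including the visits that jobs served earlier would have
   made. Re-counting the served jobs is what makes this a martingale, whatever
   the algorithm does. *)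
Definition foreseen (n : nat) h : R :=
  qsum (fh n) h.2 + past_served fh n.+1 h.1 + arrived_hits n.

Lemma arrived_hitsS n : arrived_hits n.+1 = arrived_hits n + lamN * fh n (root M).
Proof. by rewrite /arrived_hits big_ord_recr /= mulrDr. Qed.

Lemma arrived_hits_ge0 n : 0 <= arrived_hits n.
Proof.
by rewrite mulr_ge0//; apply: sumr_ge0 => m _; exact: first_hit_ge0.
Qed.

Lemma arrived_hits_le n : arrived_hits n <= lamN * hit A (root M).
Proof. by rewrite ler_wpM2l// sum_first_hit_root_le. Qed.

Lemma arrived_hits_late n : (nlevels M <= n)%N ->
  arrived_hits n = lamN * hit A (root M).
Proof. by move=> Ln; rewrite /arrived_hits sum_first_hit_root. Qed.

(** Serving a job only transfers its weight [fh n.+1] from the queue to [past_served]; new arrivals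
    supply the last term of [arrived_hits n.+1]. *)
Lemma step_foreseen n h : step h (foreseen n) = foreseen n.+1 h.
Proof.
rewrite /foreseen expectDr expectD step_qsum step_past_served arrived_hitsS.
have -> : qsum (fh n.+1) h.2 = Es (fun k => qsum (fh n.+1) (mask (alg h k) h.2)) +
    Es (fun k => qsum (fh n.+1) (unserved (alg h k) h.2)).
  rewrite -expectD -[LHS](expect_cst (fbinom N (mu_prob M))).
  by apply: eq_expect => k; exact: split_queue.
rewrite /=; ring.
Qed.

Lemma expect_foreseen t n : E t (foreseen n) = arrived_hits (n + t).
Proof.
elim: t n => [|t IH] n.
  by rewrite expect_ret /foreseen /qsum big_nil /= !add0r addn0.
rewrite /= expect_bind -addSnnS -IH; apply: eq_expect => h.
exact: step_foreseen.
Qed.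

(** Given the number of servers, the served jobs contribute a constant. The noise comes from moves
    and arrivals, each with variance at most its mean. *)
Lemma step_foreseen_sqr n h (y : R) :
  step h (fun h' => (foreseen n h' - y) ^+ 2) <=
  (foreseen n.+1 h - y) ^+ 2 + (qsum (fh n.+1) h.2 + lamN * fh n (root M)).
Proof.
rewrite expect_one_period -[X in _ <= X](expect_cst (fbinom N (mu_prob M))).
apply: le_expect => k /=.
set s := qsum (fh n.+1) (mask (alg h k) h.2).
set u := qsum (fh n.+1) (unserved (alg h k) h.2).
set c := fh n (root M).
have c0 : 0 <= c by exact: first_hit_ge0.
have c1 : c <= 1 by exact: first_hit_le1.
pose z := s + past_served fh n.+2 h.1 + arrived_hits n - y.
have -> : foreseen n.+1 h - y = u + (lamN * c + z).
  by rewrite /foreseen arrived_hitsS (split_queue h k) -/s -/u -/c /z; ring.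
apply: (@le_trans _ _ (expect (move_all (unserved (alg h k) h.2)) (fun q =>
   (qsum (fh n) q + (lamN * c + z)) ^+ 2 + lamN * c))).
  apply: le_expect => q.
  rewrite (@eq_expect _ _ _ _ (fun a => (c * a%:R + (qsum (fh n) q + z)) ^+ 2)).
    apply: le_trans (expect_fbinom_sqr _ _ _ _) _.
    rewrite lerD//; last by rewrite ler_wpM2l// expr2 ler_piMl.
    by rewrite le_eqVlt; apply/orP; left; apply/eqP; congr (_ ^+ 2); ring.
  move=> a; congr (_ ^+ 2); rewrite /foreseen /= qsum_new -/c -/s /z; ring.
rewrite expectDr [X in _ <= X]addrA lerD2r.
apply: le_trans (expect_move_all_sqr _ _ _) _ => [i|].
  by rewrite first_hit_ge0 first_hit_le1.
rewrite lerD2l; apply: (qsum_unserved_le feas) => i.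
exact: (first_hit_ge0 A n.+1).
Qed.

(** The visits of queued jobs are part of [foreseen n.+1], whose mean is known exactly and is at
    most the arrival rate. *)
Lemma expect_foreseen_increment t n :
  E t (fun h => qsum (fh n.+1) h.2 + lamN * fh n (root M)) <= N%:R.
Proof.
rewrite expectDr.
have : E t (fun h => qsum (fh n.+1) h.2) <=
    E t (fun h => foreseen n.+1 h - arrived_hits n.+1).
  apply: le_expect => h; rewrite /foreseen addrK lerDl past_served_ge0// => m i.
  exact: first_hit_ge0.
rewrite expectDr expect_foreseen arrived_hitsS.
have := arrived_hits_le (n.+1 + t); have := arrived_hits_ge0 n.
have : lamN * hit A (root M) <= lamN by rewrite ler_piMr// hit_le1.
by have := lamN_le; lra.
Qed.

(** Going back one period raises the lead [n] by one and costs variance at most [N]; leads of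
    [nlevels M] or more cost nothing, as no first visit is that far off. Hence the bound does not
    depend on [t]. *)
Lemma expect_foreseen_sqr t n :
  E t (fun h => (foreseen n h - arrived_hits (n + t)) ^+ 2) <=
  (nlevels M - n)%:R * N%:R.
Proof.
elim: t n => [|t IH] n.
  rewrite expect_ret /foreseen /qsum big_nil /= !add0r addn0 subrr expr0n.
  by rewrite mulr_ge0.
rewrite /= expect_bind -addSnnS.
apply: le_trans (le_expect _ (fun h => step_foreseen_sqr n h _)) _.
rewrite expectD; have [Ln|nL] := leqP (nlevels M) n.
  have f0 m i : (n <= m)%N -> fh m i = 0.
    by move=> nm; rewrite first_hit_late// (leq_trans Ln)// (leq_trans nm) ?leq_addl.
  rewrite [X in _ + X](_ : _ = 0) ?addr0; last first.
    rewrite f0// mulr0 expectDr addr0 -[RHS](expect_cst (law N alg t)).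
    by apply: eq_expect => h; apply: qsum0 => i; rewrite f0.
  apply: le_trans (IH _) _; rewrite ler_wpM2r// ler_nat.
  by rewrite leq_sub2l.
rewrite -(subnSK nL) -natr1 mulrDl mul1r lerD//.
exact: expect_foreseen_increment.
Qed.

Lemma expect_foreseen_dist t : (0 < N)%N ->
  E t (fun h => `|foreseen 0 h - arrived_hits t|) <=
  Num.sqrt ((nlevels M)%:R * N%:R).
Proof.
move=> N0; apply: expect_norm_le.
  by rewrite sqrtr_gt0 mulr_gt0 ?ltr0n// nlevels_gt0.
rewrite sqr_sqrtr ?mulr_ge0//.
by have := expect_foreseen_sqr t 0; rewrite subn0.
Qed.

Lemma expect_servers_dist : (0 < N)%N ->
  Es (fun n => `|n%:R - mu M * N%:R|) <= Num.sqrt ((nlevels M)%:R * N%:R).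
Proof.
move=> N0; have /andP[mu0 mu1] := mu_prob M.
have L1 : 1 <= (nlevels M)%:R :> R by rewrite ler1n nlevels_gt0.
apply: expect_norm_le.
  by rewrite sqrtr_gt0 mulr_gt0 ?ltr0n// nlevels_gt0.
rewrite sqr_sqrtr ?mulr_ge0//.
have := expect_fbinom_sqr (mu_prob M) N 1 (- (mu M * N%:R)).
rewrite (@eq_expect _ _ _ _ (fun n => (n%:R - mu M * N%:R) ^+ 2)) => [|n];
  last by rewrite mul1r.
move=> /le_trans; apply; rewrite mul1r subrr expr0n add0r expr1n mulr1.
by rewrite ler_wpM2r// (le_trans mu1).
Qed.

End FirstHitMartingale.

(** * Excess and shortage when jobs in [A] have priority *)

Lemma sum_ltn (m n : nat) : (\sum_(t < m) (t < n) = minn m n)%N.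
Proof.
elim: m => [|m IH]; first by rewrite big_ord0 min0n.
rewrite big_ord_recr /= IH; case: ltnP => mn.
  by rewrite (minn_idPl mn) addn1.
by rewrite (minn_idPr (leqW mn)) addn0.
Qed.

Section PriorityService.
Variables (R : realType) (M : model R) (N : nat) (alg : algorithm M).
Variables (before : rel (state M)) (A : pred (state M)).
Hypothesis N_gt0 : (0 < N)%N.
Hypothesis oarc : is_OaRC before alg.
Hypothesis A_first : forall i k, A i -> ~~ A k -> before i k.
Implicit Types (h : history M) (f : state M -> R).

Local Notation E t := (expect (law N alg t)).
Local Notation Es := (expect (fbinom N (mu_prob M))).
Local Notation step h := (expect (one_period N alg h)).
Local Notation lamN := (lambda M * N%:R).
Local Notation muN := (mu M * N%:R).
Local Notation fh := (first_hit A).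
Local Notation inA := (fun i => (A i)%:R).
Local Notation sLN := (Num.sqrt ((nlevels M)%:R * N%:R)).

Let theta0 : 0 <= theta M := ltW (theta_gt0 M).
Let feas : feasible alg := OaRC_feasible oarc.

Let split_queue h n f :
  qsum f h.2 = qsum f (mask (alg h n) h.2) + qsum f (unserved (alg h n) h.2).
Proof. by apply: qsum_split; have [] := feas h n. Qed.

(** Either some job of [A] is left, and then all [n] servers are busy with jobs of [A], or every job
    of [A] is served. *)
Lemma served_min h n :
  qsum inA (mask (alg h n) h.2) = Num.min n%:R (qsum inA h.2).
Proof.
have [sz cnt ord] := oarc h n.
have served_all : {in mask (alg h n) h.2, forall x, A x.2} ->
    qsum inA (mask (alg h n) h.2) = (count id (alg h n))%:R.
  move=> all_A; rewrite -(size_served feas h n) -qsum1 /qsum big_seq.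
  by rewrite [RHS]big_seq; apply: eq_bigr => x /all_A ->.
case: (boolP (has (fun x => A x.2) (unserved (alg h n) h.2))) => [/hasP[y yu Ay]|].
  have /served_all e : {in mask (alg h n) h.2, forall x, A x.2}.
    move=> x xs; apply/negPn/negP => /(A_first Ay).
    by apply/negP; exact: ord xs yu.
  have szu : (0 < size (unserved (alg h n) h.2))%N by case: (unserved _ _) yu.
  have cn : count id (alg h n) = n.
    have : (count id (alg h n) < size h.2)%N.
      rewrite -sz -(count_predC id) -[X in (X < _)%N]addn0 ltn_add2l.
      by move: szu; rewrite size_mask ?size_map// count_map.
    by rewrite cnt gtn_min ltnn orbF => /ltnW/minn_idPl.
  rewrite e cn; apply/esym/min_idPl.
  by rewrite (split_queue h n) e cn lerDl qsum_ge0.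
rewrite -all_predC => /allP nA.
have u0 : qsum inA (unserved (alg h n) h.2) = 0.
  by rewrite /qsum big_seq; apply: big1 => x /nA /=; case: (A _).
rewrite (split_queue h n) u0 addr0; apply/esym/min_idPr.
apply: (@le_trans _ _ (qsum (fun=> 1) (mask (alg h n) h.2))).
  by apply: le_qsum => i; case: (A i).
by rewrite qsum1 (size_served feas) ler_nat; have [] := feas h n.
Qed.

Definition excess h : R := Es (fun n => Num.max 0 (qsum inA h.2 - n%:R)).
Definition shortage h : R := Es (fun n => Num.max 0 (n%:R - qsum inA h.2)).

Lemma unserved_excess h n :
  qsum inA (unserved (alg h n) h.2) = Num.max 0 (qsum inA h.2 - n%:R).
Proof.
have := split_queue h n inA; rewrite served_min.
have [nX|Xn] := leP n%:R (qsum inA h.2).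
  by rewrite max_r ?subr_ge0// => ->; rewrite addrAC subrr add0r.
rewrite max_l ?subr_le0 ?(ltW Xn)// => e.
by apply: (addrI (qsum inA h.2)); rewrite -e addr0.
Qed.

Lemma served_shortage h n :
  n%:R - qsum inA (mask (alg h n) h.2) = Num.max 0 (n%:R - qsum inA h.2).
Proof.
rewrite served_min; have [nX|Xn] := leP n%:R (qsum inA h.2).
  by rewrite max_l ?subrr// subr_le0.
by rewrite max_r// subr_ge0 ltW.
Qed.

(** Potential for repeated visits: a job that was in [A] before holds the probability of being there
    again, and spends it on arrival. *)
Let returning i : R := if fresh A i then 0 else hit A i.

(* An unserved job of [A] returns to [A] with probability at most [1 - theta],
   and it must have been unserved there to return. *)
Lemma sum_returns_le T :
  \sum_(t < T) E t (fun h => qsum (fun i => (A i && ~~ fresh A i)%:R) h.2) <=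
  (1 - theta M) * \sum_(t < T) E t excess.
Proof.
have stepR h : step h (fun h' => qsum returning h'.2) <= qsum returning h.2 +
    ((1 - theta M) * excess h - qsum (fun i => (A i && ~~ fresh A i)%:R) h.2).
  rewrite step_qsum {2}/returning fresh_root mulr0 addr0 addrCA -qsumB.
  rewrite /excess -expectZ -expectDr; apply: le_expect => n.
  rewrite -unserved_excess -qsumZ.
  pose stay i : R := (~~ A i)%:R * returning i.
  have stay0 i : 0 <= stay i.
    by rewrite mulr_ge0// /returning; case: ifP => // _; exact: hit_ge0.
  have -> : qsum (fun i => returning i - (A i && ~~ fresh A i)%:R) h.2 = qsum stay h.2.
    apply: eq_qsum => i; rewrite /stay /returning; case: ifP => fi;
      rewrite /= ?andbF ?andbT.
      by rewrite mulr0 subrr.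
    by rewrite hitE; case: (A i); rewrite /= ?mul0r ?mul1r ?subrr ?subr0.
  rewrite addrC; apply: le_trans (lerD (qsum_unserved_le feas h n stay0) (lexx _)).
  rewrite -qsumD; apply: le_qsum => i; rewrite /stay.
  case: (boolP (A i)) => Ai /=.
    rewrite mul0r add0r mulr1; apply: le_trans (next_hit_le A i theta0).
    by apply: le_next => k _; rewrite /returning; case: ifP => // _; exact: hit_ge0.
  rewrite mul1r mulr0 addr0 /returning; case: ifPn => fi.
    by rewrite next0// => k /(fresh_child A) ->; rewrite Ai fi.
  rewrite hitE (negbTE Ai); apply: le_next => k /(fresh_child A) ->.
  by rewrite Ai (negbTE fi).
have := amortized_le T stepR.
have : 0 <= E T (fun h => qsum returning h.2).
  apply: expect_ge0 => h; apply: qsum_ge0 => i.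
  by rewrite /returning; case: ifP => // _; exact: hit_ge0.
move=> /le_trans/[apply]; rewrite {1}/qsum big_nil add0r.
under eq_bigr => t _ do rewrite expectB expectZ.
by rewrite sumrB -mulr_sumr subr_ge0.
Qed.

(** Fresh jobs in [A] number at most [foreseen 0], whose mean is at most that of the servers. So the
    excess is at most two fluctuations plus the returns, and the returns are absorbed on the
    left. *)
Lemma sum_excess_le T : lambda M * hit A (root M) <= mu M ->
  theta M * \sum_(t < T) E t excess <= T%:R * (2 * sLN).
Proof.
move=> lmu; have returns := sum_returns_le T.
suff : \sum_(t < T) E t excess <= \sum_(t < T) (2 * sLN) + \sum_(t < T) E t
    (fun h => qsum (fun i => (A i && ~~ fresh A i)%:R) h.2).
  by rewrite sumr_const card_ord -[_ *+ T]mulr_natl; lra.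
rewrite -big_split /=.
apply: ler_sum => t _.
apply: (@le_trans _ _ (E t (fun h => (`|foreseen N A 0 h - arrived_hits N A t| +
   Es (fun n => `|n%:R - muN|)) +
   qsum (fun i => (A i && ~~ fresh A i)%:R) h.2))); last first.
  rewrite expectD lerD2r expectDr mulr_natl mulr2n lerD//.
    exact: expect_foreseen_dist.
  exact: expect_servers_dist.
apply: le_expect => h; rewrite [_ + Es _]addrC -addrA -expectDr.
apply: le_expect => n; rewrite ge_max; apply/andP; split.
  by rewrite !addr_ge0// qsum_ge0.
have XF : qsum inA h.2 = qsum (fh 0) h.2 +
    qsum (fun i => (A i && ~~ fresh A i)%:R) h.2.
  by rewrite -qsumD; apply: eq_qsum => i /=; case: (A i); case: (fresh _ _);
    rewrite /= ?addr0 ?add0r.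
have FM : qsum (fh 0) h.2 <= foreseen N A 0 h.
  rewrite /foreseen -addrA lerDl addr_ge0 ?arrived_hits_ge0 ?past_served_ge0//.
  by move=> m i; exact: first_hit_ge0.
have am : arrived_hits N A t <= muN.
  apply: le_trans (arrived_hits_le _ _ _) _.
  by rewrite mulrAC ler_wpM2r.
have := ler_norm (foreseen N A 0 h - arrived_hits N A t).
have := ler_norm (- (n%:R - muN)); rewrite normrN XF.
by lra.
Qed.

(** Probability of a first visit [k] or more periods from now; over served jobs, this is the
    potential for missed visits. *)
Let later (k : nat) i : R := \sum_(m < nlevels M) fh (k + m) i.

Let later_rec k i : later k i = fh k i + later k.+1 i.
Proof.
rewrite /later; case: (nlevels M) (@first_hit_late _ M A) => [|L] late.
  by rewrite !big_ord0 late ?addr0.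
rewrite big_ord_recl addn0 [in RHS]big_ord_recr [X in _ = _ + (_ + X)]late ?addr0.
  by congr (_ + _); apply: eq_bigr => m _; rewrite lift0 addSnnS.
by rewrite addSnnS addnA leq_addl.
Qed.

Let past_later k l :
  past_served later k l = past_served fh k l + past_served later k.+1 l.
Proof.
elim: l k => [|p l IH] k /=; first by rewrite addr0.
by rewrite (eq_qsum _ (later_rec k)) qsumD IH; ring.
Qed.

Let later1_le i : later 1 i <= (1 - theta M) * (~~ A i)%:R.
Proof.
case: (boolP (A i)) => Ai /=.
  by rewrite mulr0 /later big1// => m _; rewrite add1n first_hitS_in.
have -> : later 1 i = next (fun k => \sum_(m < nlevels M) fh m k) i.
  by rewrite next_sum; apply: eq_bigr => m _; rewrite add1n.
apply: next_le => // k; case: (boolP (fresh A k)) => fk.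
  by rewrite sum_first_hit// hit_within_le1.
by rewrite big1// => m _; rewrite first_hit_nfresh.
Qed.

(* Only jobs served outside [A] are missed in [A] later; there are at most as
   many of them as the shortage, and each would have reached [A] with probability
   at most [1 - theta]. *)
Lemma sum_missed_le T :
  \sum_(t < T) E t (fun h => past_served fh 1 h.1) <=
  (1 - theta M) * \sum_(t < T) E t shortage.
Proof.
have th1 : 0 <= 1 - theta M by rewrite subr_ge0 theta_le1.
have stepL h : step h (fun h' => past_served later 1 h'.1) <=
    past_served later 1 h.1 + ((1 - theta M) * shortage h - past_served fh 1 h.1).
  rewrite step_past_served (past_later 1).
  suff : Es (fun n => qsum (later 1) (mask (alg h n) h.2)) <=
      (1 - theta M) * shortage h by lra.
  rewrite /shortage -expectZ; apply: le_expect => n.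
  apply: le_trans (le_qsum _ later1_le) _; rewrite qsumZ ler_wpM2l//.
  rewrite -served_shortage lerBrDr -qsumD.
  rewrite (@eq_qsum _ _ _ (fun=> 1)) => [|i]; last first.
    by case: (A i); rewrite /= ?addr0 ?add0r.
  by rewrite qsum1 (size_served feas) ler_nat; have [] := feas h n.
have := amortized_le T stepL.
have : 0 <= E T (fun h => past_served later 1 h.1).
  apply: expect_ge0 => h; apply: past_served_ge0 => k i.
  by apply: sumr_ge0 => m _; exact: first_hit_ge0.
move=> /le_trans/[apply]; rewrite /= add0r.
under eq_bigr => t _ do rewrite expectB expectZ.
by rewrite sumrB -mulr_sumr subr_ge0.
Qed.

(** Jobs in [A] number at least [foreseen 0] minus the missed ones, and these are absorbed on the
    left. The extra term pays for filling the empty system. *)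
Lemma sum_shortage_le T : mu M <= lambda M * hit A (root M) ->
  theta M * \sum_(t < T) E t shortage <=
  T%:R * (2 * sLN) + (nlevels M)%:R * N%:R.
Proof.
move=> mul; have missed := sum_missed_le T.
have /andP[mu0 mu1] := mu_prob M.
suff : \sum_(t < T) E t shortage <=
    \sum_(t < T) (2 * sLN + ((t < nlevels M)%N)%:R * N%:R) +
    \sum_(t < T) E t (fun h => past_served fh 1 h.1).
  rewrite big_split /= sumr_const card_ord -[_ *+ T]mulr_natl -mulr_suml.
  have : \sum_(t < T) (t < nlevels M)%:R <= (nlevels M)%:R :> R.
    by rewrite -natr_sum ler_nat sum_ltn geq_minr.
  move=> /(ler_wpM2r (ler0n _ N)); lra.
rewrite -big_split /=; apply: ler_sum => t _.
apply: (@le_trans _ _ (E t (fun h => (`|foreseen N A 0 h - arrived_hits N A t| +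
   (Es (fun n => `|n%:R - muN|) + ((t < nlevels M)%N)%:R * N%:R)) +
   past_served fh 1 h.1))); last first.
  rewrite expectD lerD2r expectDr addrA lerD2r mulr_natl mulr2n lerD//.
    exact: expect_foreseen_dist.
  exact: expect_servers_dist.
apply: le_expect => h.
rewrite [X in _ <= X](_ : _ = Es (fun n => `|n%:R - muN| +
  (`|foreseen N A 0 h - arrived_hits N A t| + (t < nlevels M)%:R * N%:R +
   past_served fh 1 h.1))); last by rewrite expectDr; ring.
apply: le_expect => n; rewrite ge_max; apply/andP; split.
  by rewrite !addr_ge0// ?mulr_ge0// past_served_ge0// => *; exact: first_hit_ge0.
have FX : qsum (fh 0) h.2 <= qsum inA h.2.
  by apply: le_qsum => i /=; case: (A i); case: (fresh _ _).
(* First visits reach their full mean rate by period [nlevels M]; before that the deficit is at most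
   [N]. *)
have am : muN - arrived_hits N A t <= ((t < nlevels M)%N)%:R * N%:R.
  case: ltnP => tL; last first.
    by rewrite arrived_hits_late// mul0r subr_le0 mulrAC ler_wpM2r.
  rewrite mul1r; apply: le_trans (_ : muN <= _); last by rewrite ler_piMl.
  by rewrite gerBl arrived_hits_ge0.
have := ler_norm (- (foreseen N A 0 h - arrived_hits N A t)).
have a0 : arrived_hits N A 0 = 0 by rewrite /arrived_hits big_ord0 mulr0.
have := ler_norm (n%:R - muN); rewrite normrN /foreseen a0.
by lra.
Qed.

End PriorityService.

(** * Dependence of [V] on the price and first-order conditions *)

Section CostToGo.
Variables (R : realType) (M : model R).
Implicit Types (g e : R) (i k : state M).

Let theta0 : 0 < theta M := theta_gt0 M.

Lemma cost_le_max i : cost i <= cost_max M.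
Proof. exact: le_bigmax. Qed.

Lemma cost_max_ge0 : 0 <= cost_max M.
Proof. exact: le_trans (ltW (cost_gt0 (root M))) (cost_le_max _). Qed.

Lemma bottom_up_ind (P : state M -> Prop) :
  (forall i, {in child i, forall k, P k} -> P i) -> forall i, P i.
Proof.
move=> IH i; have [n] := ubnP (nlevels M - level i); elim: n i => // n IHn i.
rewrite ltnS => le_n; apply: IH => k /level_child lk; apply: IHn.
by apply: leq_trans le_n; rewrite lk subnS prednK// subn_gt0 level_lt.
Qed.

Lemma V_ge0 g i : 0 <= g -> 0 <= V g i.
Proof.
move=> g0; elim/bottom_up_ind: i => i IH; rewrite VE le_min g0 addr_ge0//.
  exact/ltW/cost_gt0.
by apply: sumr_ge0 => k ki; rewrite mulr_ge0 ?trans_ge0 ?IH.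
Qed.

Lemma V_le_cost_max g i : V g i <= cost_max M / theta M.
Proof.
have C0 : 0 <= cost_max M / theta M by rewrite divr_ge0 ?cost_max_ge0 ?ltW.
elim/bottom_up_ind: i => i IH; rewrite VE ge_min; apply/orP; right.
have -> : cost_max M / theta M = cost_max M + (1 - theta M) * (cost_max M / theta M).
  by field; rewrite gt_eqF.
rewrite lerD ?cost_le_max//.
apply: (@le_trans _ _ (next (fun=> cost_max M / theta M) i)); first exact: le_next.
exact: next_le.
Qed.

Lemma oarc_index_le g i : oarc_index g i <= cost_max M / theta M.
Proof.
have C0 : 0 <= cost_max M / theta M by rewrite divr_ge0 ?cost_max_ge0 ?ltW.
have -> : cost_max M / theta M = cost_max M + (1 - theta M) * (cost_max M / theta M).
  by field; rewrite gt_eqF.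
by rewrite lerD ?cost_le_max// next_le// => k; exact: V_le_cost_max.
Qed.

(** Finiteness of the state space; the default 1 covers the case of no positive value. *)
Lemma exists_gap (f : state M -> R) :
  exists2 e, 0 < e & forall i, 0 < f i -> e <= f i.
Proof.
exists (\big[Num.min/1]_(i | 0 < f i) f i); first exact: lt_bigmin.
by move=> i fi; exact: bigmin_le_cond.
Qed.

Definition above g i : bool := g < oarc_index g i.
Definition at_least g i : bool := g <= oarc_index g i.

(** [hit (above g)] bounds the right derivative of [V] from below. In a state of index above [g],
    [V] is the price and rises with it in full until the gap closes; elsewhere the rise comes from
    the children. *)
Lemma V_increase g e : 0 <= e ->
  (forall i, above g i -> g + e <= oarc_index g i) ->
  forall i, V g i + e * hit (above g) i <= V (g + e) i.
Proof.
move=> e0 gap; elim/bottom_up_ind => i IH.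
have idx : oarc_index g i + e * next (hit (above g)) i <= oarc_index (g + e) i.
  rewrite /oarc_index -addrA lerD2l -[Vf g i]/(next (V g) i) -nextZ -nextD.
  exact: le_next.
have n1 : next (hit (above g)) i <= 1.
  by apply: le_trans (next_hit_le _ _ (ltW theta0)) _; rewrite gerBl ltW.
have n0 : 0 <= next (hit (above g)) i by apply: next_ge0 => k; exact: hit_ge0.
rewrite !VE -/(oarc_index _ _) -/(oarc_index _ _) hitE le_min.
case: ifPn => [Ai|]; last first.
  rewrite /above -leNgt => le_g; rewrite min_r// idx andbT lerD//.
  by rewrite ler_piMr.
have /ltW ? := Ai; rewrite min_l// mulr1 lexx /=.
apply: le_trans (gap _ Ai) _; apply: le_trans idx.
by rewrite lerDl mulr_ge0.
Qed.

Lemma V_decrease g e : 0 <= e ->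
  (forall i, ~~ at_least g i -> oarc_index g i <= g - e) ->
  forall i, V g i - e * hit (at_least g) i <= V (g - e) i.
Proof.
move=> e0 gap; elim/bottom_up_ind => i IH.
have idx : oarc_index g i - e * next (hit (at_least g)) i <= oarc_index (g - e) i.
  rewrite /oarc_index -addrA lerD2l -[Vf g i]/(next (V g) i) -mulNr -nextZ -nextD.
  by apply: le_next => k ki; rewrite mulNr IH.
have n1 : next (hit (at_least g)) i <= 1.
  by apply: le_trans (next_hit_le _ _ (ltW theta0)) _; rewrite gerBl ltW.
have n0 : 0 <= next (hit (at_least g)) i by apply: next_ge0 => k; exact: hit_ge0.
rewrite !VE -/(oarc_index _ _) -/(oarc_index _ _) hitE le_min.
case: ifPn => [Ai|nAi].
  rewrite min_l// mulr1 lexx /=; apply: le_trans idx.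
  by rewrite lerD// lerN2 ler_piMr.
have le_g := gap _ nAi; rewrite min_r; last first.
  by rewrite (le_trans le_g)// gerBl.
rewrite idx andbT (le_trans _ le_g)// gerBl.
by rewrite mulr_ge0.
Qed.

Section FirstOrderConditions.
Variable g : R.
Hypothesis hg : dual_minimizer M g.

Lemma hit_above_le : lambda M * hit (above g) (root M) <= mu M.
Proof.
have [g0 opt] := hg.
have [e e0 gap] := exists_gap (fun i => oarc_index g i - g).
have {}gap i : above g i -> g + e <= oarc_index g i.
  by rewrite /above -subr_gt0 => /gap; rewrite lerBrDl.
have := V_increase (ltW e0) gap (root M).
have := opt _ (addr_ge0 g0 (ltW e0)).
have /andP[lam0 _] := lambda_prob M.
move=> Vopt /(ler_wpM2l lam0) Vinc.
rewrite -(ler_pM2r e0); lra.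
Qed.

Lemma hit_at_least_ge : 0 < g -> mu M <= lambda M * hit (at_least g) (root M).
Proof.
move=> gt0; have [_ opt] := hg.
have [e1 e10 gap] := exists_gap (fun i => g - oarc_index g i).
(* Capping at [g] keeps the competing price [g - e] nonnegative. *)
pose e := Num.min e1 g.
have e0 : 0 < e by rewrite lt_min e10.
have eg : e <= g by rewrite ge_min lexx orbT.
have ee1 : e <= e1 by rewrite ge_min lexx.
have {}gap i : ~~ at_least g i -> oarc_index g i <= g - e.
  rewrite /at_least -ltNge -subr_gt0 => /gap; lra.
have := V_decrease (ltW e0) gap (root M).
have /andP[lam0 _] := lambda_prob M.
have : 0 <= g - e by rewrite subr_ge0.
move=> /opt Vopt /(ler_wpM2l lam0) Vdec.
rewrite -(ler_pM2r e0); lra.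
Qed.

(** A positive [g] exceeding every index would make [at_least g] empty, against the first-order
    condition and [0 < mu M]. *)
Lemma dual_minimizer_le : g <= cost_max M / theta M.
Proof.
have [g0 _] := hg; have /andP[mu0 _] := mu01 M.
have [->|gn0] := eqVneq g 0; first by rewrite divr_ge0 ?cost_max_ge0 ?ltW.
have gt0 : 0 < g by rewrite lt_neqAle eq_sym gn0.
case: (pickP (at_least g)) => [i gi|none].
  exact: le_trans gi (oarc_index_le _ _).
have h0 : hit (at_least g) (root M) = 0.
  elim/bottom_up_ind: (root M) => i IH.
  by rewrite hitE none; exact: next0.
by have := lt_le_trans mu0 (hit_at_least_ge gt0); rewrite h0 mulr0 ltxx.
Qed.

End FirstOrderConditions.
End CostToGo.

(** * Cost of OaRC against the dual value *)

Section OaRCCost.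
Variables (R : realType) (M : model R) (N : nat) (alg : algorithm M).
Variables (g : R) (before : rel (state M)).
Hypothesis N_gt0 : (0 < N)%N.
Hypothesis hg : dual_minimizer M g.
Hypothesis hbefore : tie_breaking g before.
Hypothesis oarc : is_OaRC before alg.

Local Notation E t := (expect (law N alg t)).
Local Notation Es := (expect (fbinom N (mu_prob M))).
Local Notation step h := (expect (one_period N alg h)).
Local Notation C := (cost_max M / theta M).
Local Notation sLN := (Num.sqrt ((nlevels M)%:R * N%:R)).
Local Notation dual := (N%:R * (lambda M * V g (root M) - mu M * g)).

Let g_ge0 : 0 <= g. Proof. by case: hg. Qed.
Let theta0 : 0 < theta M := theta_gt0 M.
Let C_ge0 : 0 <= C. Proof. by rewrite divr_ge0 ?cost_max_ge0 ?ltW. Qed.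

Let above_first i k : above g i -> ~~ above g k -> before i k.
Proof.
have [_ _ _ byindex] := hbefore; rewrite /above -leNgt => gi kg.
exact: byindex (le_lt_trans kg gi).
Qed.

Let at_least_first i k : at_least g i -> ~~ at_least g k -> before i k.
Proof.
have [_ _ _ byindex] := hbefore; rewrite /at_least -ltNge => gi kg.
exact: byindex (lt_le_trans kg gi).
Qed.

Lemma unserved_cost_le h :
  unserved_cost N alg h <= qsum (V g) h.2 - step h (fun h' => qsum (V g) h'.2) +
    dual + (g * shortage N (at_least g) h + C * excess N (above g) h).
Proof.
rewrite step_qsum.
suff : Es (fun n => qsum (@cost _ M) (unserved (alg h n) h.2) +
      qsum (next (V g)) (unserved (alg h n) h.2) + g * n%:R) <=
    Es (fun n => qsum (V g) h.2 +
      (g * Num.max 0 (n%:R - qsum (fun i => (at_least g i)%:R) h.2) +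
       C * Num.max 0 (qsum (fun i => (above g i)%:R) h.2 - n%:R))).
  rewrite !expectD expect_cst !expectZ expect_fbinom_mean.
  by rewrite -/(unserved_cost N alg h) -/(shortage _ _ _) -/(excess _ _ _); lra.
apply: le_expect => n.
rewrite -(unserved_excess oarc above_first) -(served_shortage oarc at_least_first).
have feas := OaRC_feasible oarc.
rewrite (qsum_split (V g) (proj1 (feas h n))).
have served_V : g * qsum (fun i => (at_least g i)%:R) (mask (alg h n) h.2) <=
    qsum (V g) (mask (alg h n) h.2).
  rewrite -qsumZ; apply: le_qsum => i; case: (boolP (at_least g i)) => gi.
    by rewrite mulr1 VE min_l.
  by rewrite mulr0 V_ge0.
have unserved_V : qsum (@cost _ M) (unserved (alg h n) h.2) +
    qsum (next (V g)) (unserved (alg h n) h.2) <=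
    qsum (V g) (unserved (alg h n) h.2) +
    C * qsum (fun i => (above g i)%:R) (unserved (alg h n) h.2).
  rewrite -qsumZ -!qsumD; apply: le_qsum => i.
  rewrite VE -[cost i + next _ i]/(oarc_index g i) -/(oarc_index g i).
  case: (boolP (above g i)) => [gi|].
    have /ltW ? := gi; rewrite min_l// mulr1.
    by apply: le_trans (oarc_index_le g i) _; rewrite lerDr.
  by rewrite /above -leNgt => ?; rewrite min_r// mulr0 addr0.
lra.
Qed.

Lemma oarc_total_cost_le T :
  E T (@total_cost _ M) <=
  T%:R * (dual + 4 * (C / theta M) * sLN) +
  C / theta M * ((nlevels M)%:R * N%:R).
Proof.
have C1 : 0 <= C / theta M by rewrite divr_ge0// ltW.
have L0 : 0 <= (nlevels M)%:R * N%:R :> R by rewrite mulr_ge0.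
have T0 : 0 <= T%:R * (2 * sLN) :> R by rewrite !mulr_ge0 ?sqrtr_ge0.
have stepV h : step h (fun h' => qsum (V g) h'.2) <= qsum (V g) h.2 +
    (g * shortage N (at_least g) h + C * excess N (above g) h
     - unserved_cost N alg h + dual).
  by have := unserved_cost_le h; lra.
have := amortized_le T stepV.
have : 0 <= E T (fun h => qsum (V g) h.2).
  by apply: expect_ge0 => h; apply: qsum_ge0 => i; rewrite V_ge0.
move=> /le_trans/[apply]; rewrite {1}/qsum big_nil add0r.
under eq_bigr => t _ do rewrite expectDr expectB expectD !expectZ.
rewrite big_split sumrB big_split /= -!mulr_sumr -expect_total_cost.
rewrite sumr_const card_ord -[_ *+ T]mulr_natl.
set SK := \sum_(t < T) E t (shortage _ _).
set SH := \sum_(t < T) E t (excess _ _).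
have SH_le : C * SH <= C / theta M * (T%:R * (2 * sLN)).
  rewrite -[C / theta M * _]mulrA ler_wpM2l//.
  rewrite [X in _ <= X]mulrC -ler_pdivrMr ?invr_gt0// invrK mulrC.
  exact: sum_excess_le N_gt0 oarc above_first T (hit_above_le hg).
have SK_le : g * SK <= C / theta M * (T%:R * (2 * sLN) + (nlevels M)%:R * N%:R).
  (* At [g = 0] the shortage carries no price; the first-order condition from the left is available
     only for [0 < g]. *)
  have [->|gn0] := eqVneq g 0; first by rewrite mul0r mulr_ge0// addr_ge0.
  have gt0 : 0 < g by rewrite lt_neqAle eq_sym gn0.
  have SK_th : SK <= (theta M)^-1 * (T%:R * (2 * sLN) + (nlevels M)%:R * N%:R).
    rewrite [X in _ <= X]mulrC -ler_pdivrMr ?invr_gt0// invrK mulrC.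
    exact: sum_shortage_le N_gt0 oarc at_least_first T (hit_at_least_ge hg gt0).
  rewrite -[C / theta M * _]mulrA; apply: le_trans (ler_wpM2l g_ge0 SK_th) _.
  rewrite ler_wpM2r ?dual_minimizer_le// mulr_ge0 ?addr_ge0//.
  by rewrite invr_ge0 ltW.
lra.
Qed.

End OaRCCost.

(** * Long-run averages and limits *)

Section Limits.
Variable R : realType.
Implicit Types (a : nat -> R) (K C e : R).

Lemma eventually_divr_le C e : 0 < e ->
  exists n, forall T, (n <= T)%N -> (0 < T)%N /\ C / T%:R <= e.
Proof.
move=> e0; exists (Num.bound (C / e)).+1 => T nT.
have T0 : (0 < T)%N by exact: leq_trans nT.
split=> //; rewrite ler_pdivrMr ?ltr0n// mulrC -ler_pdivrMr//.
apply: (@le_trans _ _ `|C / e|); first exact: ler_norm.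
apply/ltW/(lt_le_trans (unstable.ltr_norm_bound _)).
by rewrite ler_nat ltnW.
Qed.

Lemma limn_esup_mean_le a K C : (forall T, a T <= T%:R * K + C) ->
  (limn_esup (fun T => (T%:R^-1 * a T)%:E) <= K%:E)%E.
Proof.
move=> aK; apply/lee_addgt0Pr => e e0.
have [n nP] := eventually_divr_le C e0.
apply: ge_ereal_inf.
exists (ereal_sup [set (T%:R^-1 * a T)%:E | T in [set T | (n <= T)%N]]).
  by exists [set T | (n <= T)%N] => //; exact: nbhs_infty_ge.
apply: ge_ereal_sup => _ [T /nP[T0 CT] <-].
rewrite -EFinD lee_fin.
have {}T0 : 0 < T%:R :> R by rewrite ltr0n.
rewrite mulrC ler_pdivrMr// mulrDl [K * _]mulrC (le_trans (aK T))// lerD2l.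
by rewrite -ler_pdivrMr.
Qed.

Lemma limn_esup_mean_ge a K C : (forall T, T%:R * K - C <= a T) ->
  (K%:E <= limn_esup (fun T => (T%:R^-1 * a T)%:E))%E.
Proof.
move=> aK; apply/ereal_infP => _ [V [m _ mV] <-].
apply/lee_subgt0Pr => e e0.
have [n nP] := eventually_divr_le C e0.
have [T0 CT] := nP _ (leq_maxr m n).
apply: le_trans (_ : ((maxn m n)%:R^-1 * a (maxn m n))%:E <= _)%E; last first.
  apply: ereal_sup_ubound; exists (maxn m n) => //.
  exact/mV/leq_maxl.
rewrite -EFinB lee_fin; have {}T0 : 0 < (maxn m n)%:R :> R by rewrite ltr0n.
rewrite mulrC ler_pdivlMr// mulrBl [K * _]mulrC (le_trans _ (aK _))//.
by rewrite lerD2l lerN2 -ler_pdivrMr.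
Qed.

Lemma cvg_divr_sqrt (c : R) : 0 <= c ->
  (c * Num.sqrt N%:R * N%:R^-1)%:E @[N --> \oo] --> (0 : \bar R)%E.
Proof.
move=> c_ge0; apply: cvg_EFin; first by apply: nearW.
apply/cvgrPdist_le => e e0 /=.
have [n nP] := eventually_divr_le (c ^+ 2) (exprn_gt0 2 e0).
near=> N.
have [N0 Ne] : (0 < N)%N /\ c ^+ 2 / N%:R <= e ^+ 2.
  by apply: nP; near: N; exact: nbhs_infty_ge.
rewrite sub0r normrN ger0_norm ?mulr_ge0 ?sqrtr_ge0//.
rewrite -(@ler_pXn2r _ 2) ?nnegrE ?mulr_ge0 ?sqrtr_ge0 ?(ltW e0)//.
rewrite (le_trans _ Ne)// !exprMn sqr_sqrtr// -mulrA ler_wpM2l ?sqr_ge0//.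
suff -> : N%:R * N%:R^-1 ^+ 2 = N%:R^-1 :> R by [].
by field; rewrite pnatr_eq0 -lt0n.
Unshelve. all: by end_near.
Qed.

End Limits.

(** * Regret bounds *)

Section Regret.
Variables (R : realType) (M : model R) (g : R) (before : rel (state M)).
Hypothesis hg : dual_minimizer M g.
Hypothesis hbefore : tie_breaking g before.

Definition regret_factor : R :=
  4 * (cost_max M / theta M / theta M) * Num.sqrt (nlevels M)%:R.

Lemma regret_factor_ge0 : 0 <= regret_factor.
Proof.
have th := ltW (theta_gt0 M).
by rewrite !mulr_ge0 ?sqrtr_ge0 ?cost_max_ge0 ?invr_ge0.
Qed.

Lemma optimal_cost_ge N :
  ((N%:R * (lambda M * V g (root M) - mu M * g))%:E <= optimal_cost M N)%E.
Proof.
apply/ereal_infP => _ [alg feas <-].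
apply: limn_esup_mean_ge => T; apply: expect_total_cost_ge => //.
by case: hg.
Qed.

Lemma oarc_regret N (alg : algorithm M) : (0 < N)%N -> is_OaRC before alg ->
  (0 <= regret N alg <= (regret_factor * Num.sqrt N%:R)%:E)%E.
Proof.
move=> N0 oarc; set D := N%:R * (lambda M * V g (root M) - mu M * g).
have opt_ge : (D%:E <= optimal_cost M N)%E := optimal_cost_ge N.
have avg_le : (average_cost N alg <= (D + regret_factor * Num.sqrt N%:R)%:E)%E.
  rewrite /regret_factor -mulrA -sqrtrM//.
  apply: limn_esup_mean_le => T; exact: (oarc_total_cost_le N0 hg hbefore oarc).
have opt_avg : (optimal_cost M N <= average_cost N alg)%E.
  apply: ge_ereal_inf; exists (average_cost N alg) => //.
  by exists alg => //; exact: OaRC_feasible oarc.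
(* Finiteness makes the extended-real difference in [regret] meaningful; it follows from the two
   bounds around the optimum. *)
have fin : optimal_cost M N \is a fin_num.
  rewrite fin_numE; apply/andP; split.
    by apply: contraTneq opt_ge => ->.
  by apply: contraTneq (le_trans opt_avg avg_le) => ->.
rewrite /regret sube_ge0 ?fin// opt_avg /=.
apply: le_trans (leeB avg_le opt_ge) _.
by rewrite -EFinB lee_fin addrAC subrr add0r.
Qed.

Lemma regret_factor_le N : (0 < N)%N ->
  regret_factor <= cost_max M * U (nlevels M) (theta M) N.
Proof.
move=> N0; have th := theta_gt0 M.
have L0 := nlevels_gt0 M.
have x55 : 55 <= (55 * N * nlevels M)%:R :> R.
  by rewrite ler_nat -mulnA leq_pmulr// muln_gt0 N0.
have x0 : 0 < (55 * N * nlevels M)%:R :> R by exact: lt_le_trans x55.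
(* From [ln x >= 1 - 1 / x] and [x >= 2]; the constant 1610 leaves ample room. *)
have lnx : 2^-1 <= ln (55 * N * nlevels M)%:R :> R.
  have xV : (55 * N * nlevels M)%:R^-1 <= 2^-1 :> R.
    by rewrite lef_pV2 ?posrE//; lra.
  have : -1 < (55 * N * nlevels M)%:R^-1 - 1 :> R.
    by rewrite ltrBrDr addNr invr_gt0.
  move=> /le_ln1Dx; rewrite addrCA subrr addr0 lnV ?posrE//; lra.
have powL : Num.sqrt (nlevels M)%:R <= (nlevels M)%:R `^ (3 / 2) :> R.
  rewrite -powR12_sqrt// ler_powR ?ler1n//; lra.
have ln2 : 4 <= 1610 * ln (55 * N * nlevels M)%:R ^+ 2 :> R by nra.
rewrite /regret_factor /U.
have -> : 4 * (cost_max M / theta M / theta M) * Num.sqrt (nlevels M)%:R =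
    cost_max M * theta M ^- 2 * (4 * Num.sqrt (nlevels M)%:R).
  by field; rewrite gt_eqF.
set l := ln _ in ln2 *; set w := _ `^ _ in powL *; set v := theta M ^- 2.
have -> : cost_max M * (1610 * v * w * l ^+ 2) =
    cost_max M * v * (1610 * l ^+ 2 * w) by ring.
rewrite ler_wpM2l ?mulr_ge0 ?cost_max_ge0 ?invr_ge0 ?exprn_ge0 ?(ltW th)//.
by rewrite ler_pM// sqrtr_ge0.
Qed.

End Regret.

Theorem theorem1 (R : realType) (M : model R) (g : R)
    (before : rel (state M)) (OaRC : nat -> algorithm M)
    (hg : dual_minimizer M g)
    (hbefore : tie_breaking g before)
    (hOaRC : forall N : nat, (1 <= N)%N -> is_OaRC before (OaRC N)) :
  (regret N (OaRC N) * (N%:R^-1)%:E)%E @[N --> \oo] --> (0 : \bar R)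
  /\
  (forall N : nat, (1 <= N)%N ->
    (regret N (OaRC N) <=
      (cost_max M * U (nlevels M) (theta M) N * Num.sqrt N%:R)%:E)%E).
Proof.
split.
  apply: squeeze_cvge (@cvg_cst _ (0 : \bar R)%E _ _ _)
    (cvg_divr_sqrt (regret_factor_ge0 M)).
  near=> N; have N0 : (0 < N)%N by near: N; exact: nbhs_infty_ge.
  have /andP[r0 rc] := oarc_regret hg hbefore N0 (hOaRC N N0).
  have NV : (0 <= (N%:R^-1)%:E :> \bar R)%E by rewrite lee_fin invr_ge0.
  by rewrite mule_ge0//= EFinM lee_wpmul2r.
move=> N N0; have /andP[_ /le_trans] := oarc_regret hg hbefore N0 (hOaRC N N0).
by apply; rewrite lee_fin ler_wpM2r ?sqrtr_ge0// regret_factor_le.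
Unshelve. all: by end_near.
Qed.
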